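(* Let $K=\mathbb{Q}$ or let $K$ be an imaginary quadratic number field, and let $\Gamma=SL_2(\mathcal{O}_K)$, where $\mathcal{O}_K$ denotes the ring of algebraic integers in $K$. Then $\Gamma$ is a tame discrete subset of $SL_2(\mathbb{C})$.
   Context: A discrete subset of a complex manifold $X$ is a subset without accumulation points in $X$. An automorphism of $X$ is a biholomorphic self-map of the complex manifold $X$ (not necessarily a group homomorphism when $X$ is a Lie group). An exhaustion function on $X$ is a continuous function $\rho:X\to\mathbb{R}^+$ (non-negative reals) all of whose sublevel sets $\{x\in X:\rho(x)\le c\}$ are compact. An infinite discrete subset $D\subset X$ is called tame if for every exhaustion function $\rho:X\to\mathbb{R}^+$ and every map $\zeta:D\to\mathbb{R}^+$ there exists an automorphism $\phi$ of $X$ such that $\rho(\phi(x))\ge\zeta(x)$ for all $x\in D$. *)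

(* Defs.v *)
From HB Require Import structures.
From mathcomp Require Import all_boot all_order all_algebra all_field.
From mathcomp Require Import all_classical all_reals all_analysis.
From mathcomp Require Import complex.

Set Implicit Arguments.
Unset Strict Implicit.
Unset Printing Implicit Defensive.

Import Order.TTheory GRing.Theory Num.Theory.
Import numFieldNormedType.Exports.

Local Open Scope classical_set_scope.
Local Open Scope ring_scope.

(* Complex submanifolds X of a normed complex vector space V are represented
   by their underlying sets, with the induced topology and complex structure.
   A map is holomorphic on X when it is locally on X the restriction of a
   holomorphic (i.e. C-differentiable) map defined on an open subset of V;
   values of functions outside X are irrelevant. *)
Definition holomorphic_on (R : realType) (V W : normedModType R[i])
    (X : set V) (f : V -> W) : Prop :=
  forall x, X x -> exists (U : set V) (F : V -> W),
    [/\ open U, U x, forall y, U y -> differentiable F y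
      & forall y, U y -> X y -> F y = f y].

Definition automorphism (R : realType) (V : normedModType R[i])
    (X : set V) (phi : V -> V) : Prop :=
  exists psi : V -> V,
    [/\ forall x, X x -> X (phi x) /\ psi (phi x) = x,
        forall x, X x -> X (psi x) /\ phi (psi x) = x,
        holomorphic_on X phi & holomorphic_on X psi].

Definition exhaustion (R : realType) (V : normedModType R[i])
    (X : set V) (rho : V -> R) : Prop :=
  [/\ forall x, X x -> 0 <= rho x,
      {within X, continuous rho}
    & forall c : R, compact [set x | X x /\ rho x <= c]].

Definition discrete_subset (T : topologicalType) (X D : set T) : Prop :=
  D `<=` X /\ forall x, X x -> ~ limit_point D x.

Definition tame (R : realType) (V : normedModType R[i]) (X D : set V) : Prop :=
  [/\ infinite_set D, discrete_subset X D
    & forall rho : V -> R, exhaustion X rho ->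
      forall zeta : V -> R, (forall x, D x -> 0 <= zeta x) ->
      exists phi : V -> V, automorphism X phi /\
        forall x, D x -> zeta x <= rho (phi x)].

Definition SL2 (F : fieldType) : set 'M[F]_2 := [set A | \det A = 1].
Arguments SL2 F : clear implicits.

Definition ring_of_integers (K : fieldExtType rat) : set K :=
  [set x | integralOver (intr : int -> K) x].
Arguments ring_of_integers K : clear implicits.

Definition SL2_integers (K : fieldExtType rat) : set 'M[K]_2 :=
  [set A | SL2 K A /\ forall i j, ring_of_integers K (A i j)].
Arguments SL2_integers K : clear implicits.

Definition imaginary_quadratic (R : realType) (K : fieldExtType rat) : Prop :=
  \dim {:K} = 2%N /\ ~ inhabited {rmorphism K -> R}.

(* Main.v *)
Require Import Defs.
From HB Require Import structures.
From mathcomp Require Import all_boot all_order all_algebra all_field.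
From mathcomp Require Import all_classical all_reals all_analysis.
From mathcomp Require Import complex ring lra.

Set Implicit Arguments.
Unset Strict Implicit.
Unset Printing Implicit Defensive.

Import Order.TTheory GRing.Theory Num.Theory.
Import numFieldNormedType.Exports.

Local Open Scope classical_set_scope.
Local Open Scope ring_scope.

(** Only one property of the field matters: a nonzero element x of the ring
    O = iota(O_K) satisfies |x| >= 1.  This holds because |x|^2 is an algebraic
    integer that is also rational: when K is imaginary quadratic and x is not
    rational, x and its conjugate are the two roots of a monic rational
    quadratic polynomial, so |x|^2 is its constant term
    ([ring_of_integers_separated]).  For any subring O of the complex numbers
    with this property, SL_2(O) is tame ([tame_SL2_over]).

    The automorphisms used are shears: one column p of a matrix is kept, and
    g(p) p is added to the other one, where g is an entire function on C^2.  The
    inverse is the shear by -g, so no condition on g is needed.  The required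
    map is the composite of two shears.

    The matrices of SL_2(O) with a given second column p are those whose first
    column is a0 + n p, with a0 fixed and n in O.  The first shear moves this
    column to a0 + (n + g(p)) p, and g(p) is chosen so that the hermitian
    product with p becomes (n + 1/2) |p|^2.  Since |n + 1/2| >= 1/2 for every n
    in O, the new first column has size at least a constant times
    |n + 1/2| |p|.  Hence only finitely many matrices of SL_2(O) have their new
    first column in a given bounded set ([separating_shear]): these columns form
    a locally finite subset of C^2, over which the fibres are finite.

    The second shear keeps the new first column q, which is nonzero, and adds
    f(q) q to the second one.  A sublevel set of the exhaustion function is
    compact, hence bounded, so a large enough value f(q) takes the finitely many
    matrices over q out of their prescribed sublevel sets ([shear_escapes]).

    Both g and f have to take prescribed values on a locally finite subset of
    C^2; that such entire functions exist is [entire_interpolation].  They are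
    sums of polynomials, in the manner of Mittag-Leffler: the n-th polynomial
    corrects the values at the points of the n-th shell without changing those
    at the points of the previous shells, and it is tiny on a ball that grows
    with n because it contains a high power of a linear form that is 1 at the
    corrected point and small on the ball.  Smallness is measured on second
    order Taylor expansions, so that the sum is visibly complex differentiable,
    without appealing to the Cauchy formula. *)

(** * The modulus of a complex number, as a real number *)

Definition modulus (R : realType) (z : R[i]) : R := ComplexField.Normc.normc z.
Arguments modulus : simpl never.

Section Modulus.
Context {R : realType}.
Implicit Types x y z : R[i].

Lemma modulusE z : `|z| = (modulus z)%:C%C.
Proof. by []. Qed.

Lemma modulus0 : modulus (0 : R[i]) = 0.
Proof. exact: ComplexField.Normc.normc0. Qed.

Lemma modulus1 : modulus (1 : R[i]) = 1.
Proof. exact: ComplexField.Normc.normc1. Qed.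

Lemma modulusM x y : modulus (x * y) = modulus x * modulus y.
Proof. exact: ComplexField.Normc.normcM. Qed.

Lemma modulusV x : modulus x^-1 = (modulus x)^-1.
Proof. exact: ComplexField.Normc.normcV. Qed.

Lemma modulusN x : modulus (- x) = modulus x.
Proof. exact: (@normcN R x). Qed.

Lemma ler_modulusD x y : modulus (x + y) <= modulus x + modulus y.
Proof. exact: (@le_normcD R x y). Qed.

Lemma modulus_ge0 z : 0 <= modulus z.
Proof. by rewrite -ler0c -modulusE. Qed.

Lemma modulus_eq0 z : (modulus z == 0) = (z == 0).
Proof.
apply/eqP/eqP => [|->]; last exact: modulus0.
exact: ComplexField.Normc.eq0_normc.
Qed.

Lemma modulus_gt0 z : (0 < modulus z) = (z != 0).
Proof. by rewrite lt_def modulus_eq0 modulus_ge0 andbT. Qed.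

Lemma modulusBC x y : modulus (x - y) = modulus (y - x).
Proof. by rewrite -modulusN opprB. Qed.

Lemma ler_modulusB x y : modulus x - modulus y <= modulus (x - y).
Proof. by rewrite lerBlDr (le_trans _ (ler_modulusD _ _)) // subrK. Qed.

Lemma modulus_real (a : R) : modulus a%:C%C = `|a|.
Proof. by rewrite /modulus /= expr0n addr0 sqrtr_sqr. Qed.

Lemma ler_modulus_Re z : `|complex.Re z| <= modulus z.
Proof. by rewrite -lecR -modulusE normc_ge_Re. Qed.

Lemma ler_modulus_ReIm z : modulus z <= `|complex.Re z| + `|complex.Im z|.
Proof.
rewrite {1}(complexE z) (le_trans (ler_modulusD _ _)) // modulusM !modulus_real.
have -> : modulus ('i%C : R[i]) = 1.
  by rewrite /modulus /= expr0n expr1n add0r sqrtr1.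
by rewrite mul1r.
Qed.

Lemma ler_modulus_Im z : `|complex.Im z| <= modulus z.
Proof.
have := ler_modulus_Re (z * 'i%C); rewrite ReiNIm normrN modulusM.
by rewrite {2}/modulus /= expr0n expr1n add0r sqrtr1 mulr1.
Qed.

Lemma modulus_half : modulus (2^-1 : R[i]) = 2^-1.
Proof.
by rewrite modulusV -(rmorph_nat (real_complex R)) modulus_real ger0_norm.
Qed.

Lemma modulus_conj z : modulus (z^*)%C = modulus z.
Proof. by case: z => a b; rewrite /modulus /= sqrrN. Qed.

End Modulus.

(** * Taylor bounds on polydiscs *)

Section Jets.
Context {R : realType}.
Local Notation C := R[i].
Local Notation plane := (C * C)%type.
Implicit Types (p x y : plane) (F G : plane -> C).

(** A function on C^2 together with candidates for its two partial derivatives.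
    Carrying the candidates along makes the passage to the limit elementary:
    they converge just like the function. *)
Record jet := Jet { jval :> plane -> C; jd1 : plane -> C; jd2 : plane -> C }.
Implicit Types J K : jet.

Definition polydisc (r : R) : set plane :=
  [set p | modulus p.1 < r /\ modulus p.2 < r].

Definition dist1 x y : R := modulus (y.1 - x.1) + modulus (y.2 - x.2).

(** One constant [M] bounds all the terms of the first order expansion, and its
    remainder.  The Lipschitz bound is listed so that the class is stable under
    products with the multiplicative constant 3 of [taylorM]. *)
Definition taylor (r M : R) J := 0 <= M /\
  forall x y, polydisc r x -> polydisc r y ->
  [/\ modulus (J x) <= M, modulus (jd1 J x) <= M, modulus (jd2 J x) <= M,
      modulus (J y - J x) <= M * dist1 x y
    & modulus (J y - J x - (jd1 J x * (y.1 - x.1) + jd2 J x * (y.2 - x.2)))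
      <= M * dist1 x y ^+ 2].

(** A quadratic remainder on every polydisc forces complex differentiability
    everywhere, see [differentiable_jet]. *)
Definition entire J := forall r : R, exists M, taylor r M J.

Definition jcst c := Jet (fun=> c) (fun=> 0) (fun=> 0).
Definition jfst := Jet (fun p => p.1) (fun=> 1) (fun=> 0).
Definition jsnd := Jet (fun p => p.2) (fun=> 0) (fun=> 1).
Definition jadd J K :=
  Jet (fun p => J p + K p) (fun p => jd1 J p + jd1 K p)
      (fun p => jd2 J p + jd2 K p).
Definition jmul J K :=
  Jet (fun p => J p * K p) (fun p => jd1 J p * K p + J p * jd1 K p)
      (fun p => jd2 J p * K p + J p * jd2 K p).

Lemma dist1_ge0 x y : 0 <= dist1 x y.
Proof. by rewrite addr_ge0 ?modulus_ge0. Qed.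

Lemma taylorW r M N J : M <= N -> taylor r M J -> taylor r N J.
Proof.
move=> MN [M0 tJ]; split=> [|x y rx ry]; first exact: le_trans MN.
have [h1 h2 h3 h4 h5] := tJ x y rx ry.
by split; try exact: le_trans MN; [apply: (le_trans h4) | apply: (le_trans h5)];
  rewrite ler_wpM2r ?exprn_ge0 ?dist1_ge0.
Qed.

Lemma taylor_cst r c : taylor r (modulus c) (jcst c).
Proof.
split=> [|x y _ _ /=]; first exact: modulus_ge0.
split; rewrite ?modulus0 ?modulus_ge0 //.
  by rewrite subrr modulus0 mulr_ge0 ?modulus_ge0 ?dist1_ge0.
rewrite subrr !mul0r addr0 subr0 modulus0.
by rewrite mulr_ge0 ?modulus_ge0 ?exprn_ge0 ?dist1_ge0.
Qed.

Lemma taylor_fst r : taylor r (Num.max r 1) jfst.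
Proof.
have m0 : 0 <= Num.max r 1 by rewrite le_max ler01 orbT.
split=> [//|x y [/ltW rx _] _ /=].
split; rewrite ?modulus1 ?modulus0 //; first by rewrite le_max rx.
- by rewrite le_max lexx orbT.
- apply: (@le_trans _ _ (1 * dist1 x y)).
    by rewrite mul1r lerDl modulus_ge0.
  by rewrite ler_wpM2r ?dist1_ge0 // le_max lexx orbT.
- by rewrite mul1r mul0r addr0 subrr modulus0 mulr_ge0 ?exprn_ge0 ?dist1_ge0.
Qed.

Lemma taylor_snd r : taylor r (Num.max r 1) jsnd.
Proof.
have m0 : 0 <= Num.max r 1 by rewrite le_max ler01 orbT.
split=> [//|x y [_ /ltW rx] _ /=].
split; rewrite ?modulus1 ?modulus0 //; first by rewrite le_max rx.
- by rewrite le_max lexx orbT.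
- apply: (@le_trans _ _ (1 * dist1 x y)).
    by rewrite mul1r lerDr modulus_ge0.
  by rewrite ler_wpM2r ?dist1_ge0 // le_max lexx orbT.
- by rewrite mul1r mul0r add0r subrr modulus0 mulr_ge0 ?exprn_ge0 ?dist1_ge0.
Qed.

Lemma taylorD r M N J K :
  taylor r M J -> taylor r N K -> taylor r (M + N) (jadd J K).
Proof.
move=> [M0 tJ] [N0 tK]; split=> [|x y rx ry /=]; first exact: addr_ge0.
have [a1 a2 a3 a4 a5] := tJ x y rx ry; have [b1 b2 b3 b4 b5] := tK x y rx ry.
split; try by apply: (le_trans (ler_modulusD _ _)); exact: lerD.
- rewrite opprD addrACA [leRHS]mulrDl.
  by apply: (le_trans (ler_modulusD _ _)); exact: lerD.
- rewrite [leRHS]mulrDl; apply: (le_trans _ (lerD a5 b5)).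
  apply: (le_trans _ (ler_modulusD _ _)); rewrite le_eqVlt; apply/orP; left.
  by apply/eqP; congr modulus; ring.
Qed.

(** The increment of a product is the first order part plus the product of the
    two increments; the latter is of second order by the Lipschitz bounds, which
    is where the third copy of [M * N] comes from. *)
Lemma taylorM r M N J K :
  taylor r M J -> taylor r N K -> taylor r (3 * M * N) (jmul J K).
Proof.
move=> [M0 tJ] [N0 tK].
have MN0 : 0 <= M * N by rewrite mulr_ge0.
split=> [|x y rx ry /=]; first by rewrite -mulrA mulr_ge0.
have [a1 a2 a3 a4 a5] := tJ x y rx ry; have [b1 b2 b3 b4 b5] := tK x y rx ry.
have [b1' _ _ _ _] := tK y x ry rx.
have d0 := dist1_ge0 x y; set d := dist1 x y in a4 a5 b4 b5 d0 *.
have P u v (A B : R) : modulus u <= A -> modulus v <= B ->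
    modulus (u * v) <= A * B.
  by move=> uA vB; rewrite modulusM ler_pM ?modulus_ge0.
have MNd0 : 0 <= M * N * d by rewrite mulr_ge0.
have MNdd0 : 0 <= M * N * d ^+ 2 by rewrite mulr_ge0 ?exprn_ge0.
have Pd u v u' v' : modulus u <= M -> modulus v <= N -> modulus u' <= M ->
    modulus v' <= N -> modulus (u * v + u' * v') <= 3 * M * N.
  move=> h1 h2 h3 h4; apply: le_trans (ler_modulusD _ _) _.
  by have := P _ _ _ _ h1 h2; have := P _ _ _ _ h3 h4; lra.
split; try exact: Pd.
- by have := P _ _ _ _ a1 b1; lra.
- have -> : J y * K y - J x * K x = (J y - J x) * K y + J x * (K y - K x).
    by ring.
  apply: le_trans (ler_modulusD _ _) _.
  by have := P _ _ _ _ a4 b1'; have := P _ _ _ _ a1 b4; lra.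
- have -> : J y * K y - J x * K x -
      ((jd1 J x * K x + J x * jd1 K x) * (y.1 - x.1) +
       (jd2 J x * K x + J x * jd2 K x) * (y.2 - x.2)) =
    (J y - J x - (jd1 J x * (y.1 - x.1) + jd2 J x * (y.2 - x.2))) * K x +
    J x * (K y - K x - (jd1 K x * (y.1 - x.1) + jd2 K x * (y.2 - x.2))) +
    (J y - J x) * (K y - K x) by ring.
  apply: le_trans (ler_modulusD _ _) _.
  have := P _ _ _ _ a4 b4.
  have := ler_modulusD
    ((J y - J x - (jd1 J x * (y.1 - x.1) + jd2 J x * (y.2 - x.2))) * K x)
    (J x * (K y - K x - (jd1 K x * (y.1 - x.1) + jd2 K x * (y.2 - x.2)))).
  have := P _ _ _ _ a5 b1; have := P _ _ _ _ a1 b5.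
  have -> : 3 * M * N * d ^+ 2 =
      M * N * d ^+ 2 + M * N * d ^+ 2 + M * N * d ^+ 2.
    by ring.
  have -> : M * d ^+ 2 * N = M * N * d ^+ 2 by ring.
  have -> : M * (N * d ^+ 2) = M * N * d ^+ 2 by ring.
  have -> : M * d * (N * d) = M * N * d ^+ 2 by ring.
  by lra.
Qed.

Lemma entire_cst c : entire (jcst c).
Proof. by move=> r; eexists; exact: taylor_cst. Qed.

Lemma entire_fst : entire jfst.
Proof. by move=> r; eexists; exact: taylor_fst. Qed.

Lemma entire_snd : entire jsnd.
Proof. by move=> r; eexists; exact: taylor_snd. Qed.

Lemma entireD J K : entire J -> entire K -> entire (jadd J K).
Proof.
by move=> eJ eK r; have [[M tJ] [N tK]] := (eJ r, eK r);
   exists (M + N); exact: taylorD.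
Qed.

Lemma entireM J K : entire J -> entire K -> entire (jmul J K).
Proof.
by move=> eJ eK r; have [[M tJ] [N tK]] := (eJ r, eK r);
   exists (3 * M * N); exact: taylorM.
Qed.

End Jets.

(** * Polynomials with prescribed values that are small on a polydisc *)

Section Interpolation.
Context {R : realType}.
Local Notation C := R[i].
Local Notation plane := (C * C)%type.
Implicit Types (p q x y : plane) (J K P : @jet R) (s A : seq plane).

Definition sup_modulus p : R := Num.max (modulus p.1) (modulus p.2).

(** The usual Lagrange product, in which each point of [s] is separated from
    [p] by a coordinate in which they differ. *)
Lemma lagrange_jet p s : p \notin s ->
  exists J, [/\ entire J, J p = 1 & forall q, q \in s -> J q = 0].
Proof.
elim: s => [_|q s IHs]; first by exists (jcst 1); split=> //; exact: entire_cst.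
rewrite in_cons negb_or => /andP[pq /IHs[J [eJ Jp Js]]].
have [K [eK Kp Kq]] : exists K, [/\ entire K, K p = 1 & K q = 0].
  have [pq1|pq1] := eqVneq p.1 q.1; last first.
    exists (jmul (jcst (p.1 - q.1)^-1) (jadd (@jfst R) (jcst (- q.1)))).
    split=> /=; last by rewrite subrr mulr0.
      by apply: entireM; [exact: entire_cst|apply: entireD;
        [exact: entire_fst|exact: entire_cst]].
    by rewrite mulVf // subr_eq0.
  have pq2 : p.2 != q.2.
    by apply: contra pq => /eqP pq2; rewrite [p]surjective_pairing pq1 pq2
      -surjective_pairing.
  exists (jmul (jcst (p.2 - q.2)^-1) (jadd (@jsnd R) (jcst (- q.2)))).
  split=> /=; last by rewrite subrr mulr0.
    by apply: entireM; [exact: entire_cst|apply: entireD;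
      [exact: entire_snd|exact: entire_cst]].
  by rewrite mulVf // subr_eq0.
exists (jmul K J); split=> /= [||q']; first exact: entireM.
- by rewrite Kp Jp mulr1.
- by rewrite in_cons => /orP[/eqP ->|/Js ->]; rewrite ?Kq ?mul0r ?mulr0.
Qed.

Lemma taylor_scaled_coord (r : R) (c : C) (J : jet) : 1 <= r ->
  J = @jfst R \/ J = @jsnd R -> taylor r (modulus c * r) (jmul (jcst c) J).
Proof.
move=> r1 hJ; have r0 : 0 <= r by exact: le_trans r1.
have c0 := modulus_ge0 c.
have cr : modulus c <= modulus c * r by rewrite ler_peMr.
have cr0 : 0 <= modulus c * r by rewrite mulr_ge0.
split=> // x y [/ltW rx1 /ltW rx2] _.
have xy0 := dist1_ge0 x y.
case: hJ => -> /=; split.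
all: rewrite ?mul0r ?add0r ?mulr1 ?mulr0 ?modulus0 //.
all: rewrite ?modulusM ?ler_wpM2l //.
- rewrite -mulrBr modulusM -mulrA ler_wpM2l //.
  apply: le_trans (_ : dist1 x y <= _); first by rewrite lerDl modulus_ge0.
  by rewrite ler_peMl.
- rewrite (_ : modulus _ = 0) ?mulr_ge0 ?exprn_ge0 //.
  by rewrite -[RHS](@modulus0 R); congr modulus; ring.
- rewrite -mulrBr modulusM -mulrA ler_wpM2l //.
  apply: le_trans (_ : dist1 x y <= _); first by rewrite lerDr modulus_ge0.
  by rewrite ler_peMl.
- rewrite (_ : modulus _ = 0) ?mulr_ge0 ?exprn_ge0 //.
  by rewrite -[RHS](@modulus0 R); congr modulus; ring.
Qed.

Definition jexp J n : jet := iter n (jmul J) (jcst 1).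

Lemma jexpE J n p : jexp J n p = J p ^+ n.
Proof. by elim: n => [|n IHn] //=; rewrite -/(jexp J n) IHn exprS. Qed.

Lemma entireX J n : entire J -> entire (jexp J n).
Proof.
by move=> eJ; elim: n => [|n IHn]; [exact: entire_cst|exact: entireM].
Qed.

(** The constant 1/6 beats the factor 3 that each product costs, with a factor
    1/2 to spare. *)
Lemma taylorX (r : R) J n : taylor r 6^-1 J -> taylor r (2^-1 ^+ n) (jexp J n).
Proof.
move=> tJ; elim: n => [|n IHn].
  by rewrite expr0 -[1](@modulus1 R); exact: taylor_cst.
apply: taylorW (taylorM tJ IHn); rewrite exprS.
have : 0 <= 2^-1 ^+ n :> R by rewrite exprn_ge0 // invr_ge0.
lra.
Qed.

Lemma half_exp_small (M e : R) : 0 <= M -> 0 < e ->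
  exists n, M * 2^-1 ^+ n <= e.
Proof.
move=> M0 e0; exists (Num.truncn (M / e)).+1.
have h : M / e <= (Num.truncn (M / e)).+1%:R.
  by rewrite ltW // truncnS_gt.
have h2 : (Num.truncn (M / e)).+1%:R <= 2 ^+ (Num.truncn (M / e)).+1 :> R.
  by rewrite -natrX ler_nat ltnW // ltn_expl.
rewrite exprVn ler_pdivrMr ?exprn_gt0 // mulrC -ler_pdivrMr //.
exact: le_trans h2.
Qed.

(** A Lagrange polynomial times a high power of the linear form z_i / p_i, for an
    index i with |p_i| >= 6 n: this form is 1 at [p] and at most 1/6 on the
    polydisc of radius [n].  For [n = 0] the polydisc is empty and the
    Lagrange polynomial suffices. *)
Lemma small_bump (n : nat) (e : R) p s (w : C) : 0 < e ->
  6 * n%:R <= sup_modulus p -> p \notin s ->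
  exists P, [/\ entire P, taylor n%:R e P, P p = w
    & forall q, q \in s -> P q = 0].
Proof.
move=> e0 np ps; have [J [eJ Jp Js]] := lagrange_jet ps.
case: n np => [_|n np].
  exists (jmul (jcst w) J); split=> [||/=|q /Js /= ->].
  - by apply: entireM => //; exact: entire_cst.
  - split; first exact: ltW.
    move=> x y [x0 _]; have : modulus x.1 < 0 := x0.
    by rewrite ltNge modulus_ge0.
  - by rewrite Jp mulr1.
  - by rewrite mulr0.
pose r : R := n.+1%:R; have r1 : 1 <= r by rewrite ler1n.
have r0 : 0 < r by rewrite ltr0n.
have [H [eH tH Hp]] : exists H : jet, [/\ entire H, taylor r 6^-1 H & H p = 1].
  have inv c : 6 * r <= modulus c -> c != 0 /\ modulus c^-1 * r <= 6^-1.
    move=> hc; have c0 : 0 < modulus c.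
      by apply: lt_le_trans hc; rewrite mulr_gt0.
    split; first by rewrite -modulus_gt0.
    by rewrite modulusV mulrC ler_pdivrMr // ler_pdivlMl //.
  move: np; rewrite /sup_modulus le_max => /orP[] /inv[c0 hc].
    exists (jmul (jcst p.1^-1) (@jfst R)); split=> /=.
    - by apply: entireM; [exact: entire_cst|exact: entire_fst].
    - by apply: taylorW hc _; apply: taylor_scaled_coord => //; left.
    - by rewrite mulVf.
  exists (jmul (jcst p.2^-1) (@jsnd R)); split=> /=.
  - by apply: entireM; [exact: entire_cst|exact: entire_snd].
  - by apply: taylorW hc _; apply: taylor_scaled_coord => //; right.
  - by rewrite mulVf.
have eQ : entire (jmul (jcst w) J) by apply: entireM => //; exact: entire_cst.
have [M tM] := eQ r.
have [N hN] : exists N, 3 * M * 2^-1 ^+ N <= e.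
  by apply: half_exp_small => //; rewrite mulr_ge0 //; case: tM.
exists (jmul (jmul (jcst w) J) (jexp H N)); split=> [||/=|q /Js /= ->].
- by apply: entireM => //; exact: entireX.
- by apply: taylorW hN _; apply: taylorM => //; exact: taylorX.
- by rewrite jexpE Hp Jp expr1n !mulr1.
- by rewrite mulr0 mul0r.
Qed.

(** The points of [A] are those at which the values are to be left alone; they
    may lie inside the polydisc. *)
Lemma small_interpolation (n : nat) s A (w : plane -> C) (e : R) : 0 < e ->
  (forall p, p \in s -> 6 * n%:R <= sup_modulus p /\ p \notin A) ->
  exists P, [/\ entire P, taylor n%:R e P, forall p, p \in s -> P p = w p
    & forall p, p \in A -> P p = 0].
Proof.
elim: s e A => [|p s IHs] e A e0 sA.
  exists (jcst 0); split=> //; first exact: entire_cst.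
  by apply: taylorW (taylor_cst _ _); rewrite modulus0 ltW.
have [ps|ps] := boolP (p \in s).
  have [|P [eP tP Ps PA]] := IHs e A e0.
    by move=> q qs; apply: sA; rewrite in_cons qs orbT.
  exists P; split=> // q; rewrite in_cons => /orP[/eqP ->|]; exact: Ps.
have e2 : 0 < e / 2 by rewrite divr_gt0.
have [|P [eP tP Ps PA]] := IHs (e / 2) (p :: A) e2.
  move=> q qs; have [|nq qA] := sA q; first by rewrite in_cons qs orbT.
  split=> //; rewrite in_cons negb_or qA andbT.
  by apply: contra ps => /eqP <-.
have [np pA] := sA p (mem_head _ _).
have psA : p \notin s ++ A by rewrite mem_cat negb_or ps.
have [Q [eQ tQ Qp Qs]] := small_bump (w p) e2 np psA.
exists (jadd P Q); split=> [||q|q qA /=]; first exact: entireD.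
- by rewrite [e]splitr; exact: taylorD.
- rewrite in_cons => /orP[/eqP ->|qs] /=.
    by rewrite Qp PA ?mem_head // add0r.
  by rewrite Ps // Qs ?mem_cat ?qs // addr0.
- by rewrite PA ?in_cons ?qA ?orbT // Qs ?mem_cat ?qA ?orbT // addr0.
Qed.

(** Subtracting from, or adding to, a sequence with geometric increments twice
    the current bound makes it monotone, so the limit of each coordinate is a
    supremum, with an explicit rate. *)
Lemma complex_geometric_limit (u : nat -> C) (m : nat) :
  (forall n, (m <= n)%N -> modulus (u n.+1 - u n) <= 2^-1 ^+ n) ->
  exists l, forall n, (m <= n)%N -> modulus (u n - l) <= 4 * 2^-1 ^+ n.
Proof.
move=> hu.
have real_limit (a : nat -> R) :
    (forall n, (m <= n)%N -> `|a n.+1 - a n| <= 2^-1 ^+ n) ->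
    exists l, forall n, (m <= n)%N -> `|a n - l| <= 2 * 2^-1 ^+ n.
  move=> ha; pose t n : R := 2 * 2^-1 ^+ n.
  have t0 n : 0 <= t n by rewrite mulr_ge0 // exprn_ge0 // invr_ge0.
  have tS n : t n.+1 = t n - 2^-1 ^+ n by rewrite /t exprS; lra.
  have mono n k : (m <= n)%N ->
      a n - t n <= a (n + k)%N - t (n + k)%N /\
      a (n + k)%N + t (n + k)%N <= a n + t n.
    move=> mn; elim: k => [|k [IH1 IH2]]; first by rewrite addn0.
    have := ha _ (leq_trans mn (leq_addr k n)); rewrite ler_norml => /andP[].
    by rewrite addnS tS; lra.
  pose A := [set a n - t n | n in [set n | (m <= n)%N]].
  have below n k : (m <= n)%N -> (m <= k)%N -> a n - t n <= a k + t k.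
    move=> mn mk; have [h1 _] := mono n k mn; have [_ h2] := mono k n mk.
    have := t0 (n + k)%N; rewrite addnC in h2; lra.
  have supA : has_sup A.
    split; first by exists (a m - t m); exists m => /=.
    by exists (a m + t m) => _ [n mn <-]; exact: below.
  exists (sup A) => n mn; rewrite ler_norml.
  have h1 : a n - t n <= sup A by apply: sup_upper_bound => //; exists n.
  have h2 : sup A <= a n + t n.
    by apply: sup_le_ub; [case: supA|move=> _ [k mk <-]; exact: below].
  by rewrite -/(t n); apply/andP; split; lra.
have [|l1 hl1] := real_limit (fun n => complex.Re (u n)).
  by move=> n /hu; apply: le_trans; rewrite -raddfB ler_modulus_Re.
have [|l2 hl2] := real_limit (fun n => complex.Im (u n)).
  by move=> n /hu; apply: le_trans; rewrite -raddfB ler_modulus_Im.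
exists (l1 +i* l2)%C => n mn; apply: le_trans (ler_modulus_ReIm _) _.
have -> : complex.Re (u n - (l1 +i* l2)%C) = complex.Re (u n) - l1.
  by rewrite raddfB.
have -> : complex.Im (u n - (l1 +i* l2)%C) = complex.Im (u n) - l2.
  by rewrite raddfB.
by have := hl1 n mn; have := hl2 n mn; lra.
Qed.

End Interpolation.

(** * Entire functions with prescribed values on a locally finite set *)

Section EntireInterpolation.
Context {R : realType}.
Local Notation C := R[i].
Local Notation plane := (C * C)%type.
Implicit Types (p q x y : plane) (J K P : @jet R).

Lemma polydiscE (r : R) p : polydisc r p <-> sup_modulus p < r.
Proof. by rewrite /sup_modulus gt_max; split=> [[-> ->]|/andP[]]. Qed.

Lemma polydiscW (r r' : R) p : r <= r' -> polydisc r p -> polydisc r' p.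
Proof. by move=> rr' [h1 h2]; split; exact: lt_le_trans rr'. Qed.

Lemma taylorWr (r r' M : R) J : r <= r' -> taylor r' M J -> taylor r M J.
Proof.
move=> rr' [M0 tJ]; split=> // x y rx ry.
by apply: tJ; exact: polydiscW rr' _.
Qed.

Definition jet_close (r e : R) J K := forall x, polydisc r x ->
  [/\ modulus (J x - K x) <= e, modulus (jd1 J x - jd1 K x) <= e
    & modulus (jd2 J x - jd2 K x) <= e].

(** For fixed points x and y each of the bounds is a closed condition on the
    values at x and y of the function and of its candidate derivatives. *)
Lemma taylor_closed (r M : R) K :
  (forall e, 0 < e -> exists2 J, taylor r M J & jet_close r e J K) ->
  taylor r M K.
Proof.
move=> hK; split=> [|x y rx ry]; first by have [J []] := hK 1 ltr01.
have tri (u v : C) (a e : R) : modulus u <= a -> modulus (u - v) <= e ->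
    modulus v <= a + e.
  move=> ua uve; have -> : v = u + - (u - v) by ring.
  by apply: le_trans (ler_modulusD _ _) _; rewrite modulusN lerD.
have closeB e J : jet_close r e J K ->
    modulus (J y - J x - (K y - K x)) <= 2 * e.
  move=> cJ; have [hx _ _] := cJ x rx; have [hy _ _] := cJ y ry.
  have -> : J y - J x - (K y - K x) = J y - K y - (J x - K x) by ring.
  by apply: le_trans (ler_modulusD _ _) _; rewrite modulusN; lra.
split; apply/ler_addgt0Pr => e e0.
- have [J [_ tJ] cJ] := hK e e0; have [h _ _] := cJ x rx.
  by have [h1 _ _ _ _] := tJ x y rx ry; exact: tri h.
- have [J [_ tJ] cJ] := hK e e0; have [_ h _] := cJ x rx.
  by have [_ h1 _ _ _] := tJ x y rx ry; exact: tri h.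
- have [J [_ tJ] cJ] := hK e e0; have [_ _ h] := cJ x rx.
  by have [_ _ h1 _ _] := tJ x y rx ry; exact: tri h.
- have e2 : 0 < e / 2 by rewrite divr_gt0.
  have [J [_ tJ] cJ] := hK _ e2; have [_ _ _ h1 _] := tJ x y rx ry.
  by apply: tri h1 _; apply: le_trans (closeB _ _ cJ) _; rewrite mulrC divfK.
- have d0 := dist1_ge0 x y; have d2 : 0 < 2 + dist1 x y by lra.
  have e2 : 0 < e / (2 + dist1 x y) by rewrite divr_gt0.
  have [J [_ tJ] cJ] := hK _ e2; have [_ _ _ _ h1] := tJ x y rx ry.
  apply: tri h1 _; have := closeB _ _ cJ; have [_ c1 c2] := cJ x rx.
  set e' := e / _ in c1 c2 * => cB.
  set u := y.1 - x.1; set v := y.2 - x.2.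
  have -> : J y - J x - (jd1 J x * u + jd2 J x * v) -
      (K y - K x - (jd1 K x * u + jd2 K x * v)) =
      (J y - J x - (K y - K x)) -
      ((jd1 J x - jd1 K x) * u + (jd2 J x - jd2 K x) * v) by ring.
  apply: le_trans (ler_modulusD _ _) _; rewrite modulusN.
  have := ler_modulusD ((jd1 J x - jd1 K x) * u) ((jd2 J x - jd2 K x) * v).
  rewrite !modulusM.
  have := ler_wpM2r (modulus_ge0 u) c1; have := ler_wpM2r (modulus_ge0 v) c2.
  have -> : e = e' * 2 + e' * modulus u + e' * modulus v.
    rewrite -!mulrDr -addrA -/(dist1 x y) /e' divfK //.
    by rewrite gt_eqF.
  lra.
Qed.

(** The hypothesis controls the n-th increment only on the polydisc of radius
    [n], so the sequence at x is geometric only from the least such radius on;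
    the conclusion is nevertheless uniform on every polydisc. *)
Lemma geometric_pointwise_limit (u : nat -> plane -> C) :
  (forall n x, polydisc n%:R x -> modulus (u n.+1 x - u n x) <= 2^-1 ^+ n) ->
  exists f, forall m n x, (m <= n)%N -> polydisc m%:R x ->
    modulus (u n x - f x) <= 4 * 2^-1 ^+ n.
Proof.
move=> hu; pose m0 x := (Num.truncn (sup_modulus x)).+1.
have hm0 x : polydisc (m0 x)%:R x by apply/polydiscE; exact: truncnS_gt.
have /choice[f hf] : forall x, exists l, forall n, (m0 x <= n)%N ->
    modulus (u n x - l) <= 4 * 2^-1 ^+ n.
  move=> x; apply: (@complex_geometric_limit _ (u ^~ x)) => n mn.
  by apply: hu; apply: polydiscW (hm0 x); rewrite ler_nat.
exists f => m n x mn /polydiscE mx; apply: hf; apply: leq_trans mn.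
rewrite -(ltr_nat R); apply: le_lt_trans mx.
have s0 : 0 <= sup_modulus x by rewrite le_max modulus_ge0.
by have /andP[] := truncn_itv s0.
Qed.

(** Shells of thickness 6 match the ratio 6 between the norm of a corrected point
    and the radius of the polydisc in [small_bump]. *)
Theorem entire_interpolation (E : set plane) (v : plane -> C) :
  (forall r : R, finite_set [set p | E p /\ sup_modulus p < r]) ->
  exists2 F, entire F & forall p, E p -> F p = v p.
Proof.
move=> finE.
have /choice[A hA] : forall n : nat, exists s : seq plane,
    [set p | E p /\ sup_modulus p < 6 * n%:R] = [set` s].
  by move=> n; exact/finite_seqP/finE.
have inA n p : p \in A n <-> E p /\ sup_modulus p < 6 * n%:R.
  by have := congr1 (@^~ p) (hA n) => /= ->.
have /choice[step hstep] : forall nS : nat * jet, exists P,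
    [/\ entire P, taylor nS.1%:R (2^-1 ^+ nS.1) P,
      forall p, p \in A nS.1.+1 -> p \notin A nS.1 -> P p = v p - nS.2 p
    & forall p, p \in A nS.1 -> P p = 0].
  move=> -[n S] /=.
  have e0 : 0 < 2^-1 ^+ n :> R by rewrite exprn_gt0 // invr_gt0.
  pose s := [seq p <- A n.+1 | p \notin A n].
  have hs p : p \in s -> 6 * n%:R <= sup_modulus p /\ p \notin A n.
    rewrite mem_filter => /andP[pA /inA[Ep _]]; split=> //.
    by rewrite leNgt; apply: contra pA => np; apply/inA.
  have [P [eP tP Ps PA]] := small_interpolation (fun p => v p - S p) e0 hs.
  exists P; split=> // p pn pA; apply: Ps; rewrite mem_filter pA //.
pose G := fix G n := if n is n'.+1 then jadd (G n') (step (n', G n'))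
                     else jcst (0 : C).
have eG n : entire (G n).
  elim: n => [|n IHn] /=; first exact: entire_cst.
  by apply: entireD => //; have [] := hstep (n, G n).
have GA n p : p \in A n -> G n p = v p.
  elim: n => [|n IHn] /=.
    move=> /inA[_]; rewrite mulr0 ltNge => /negP[].
    by rewrite le_max modulus_ge0.
  move=> pn; have [_ _ h1 h2] := hstep (n, G n).
  have [pA|pA] := boolP (p \in A n); first by rewrite h2 // IHn // addr0.
  by rewrite h1 // addrC subrK.
(* the case x = y of the Taylor bounds already controls the three increments *)
have step_small n x : polydisc n%:R x ->
    [/\ modulus (step (n, G n) x) <= 2^-1 ^+ n,
        modulus (jd1 (step (n, G n)) x) <= 2^-1 ^+ n
      & modulus (jd2 (step (n, G n)) x) <= 2^-1 ^+ n].
  by move=> nx; have [_ [_ /(_ x x nx nx)[]]] := hstep (n, G n).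
have [|f hf] := @geometric_pointwise_limit (fun n => jval (G n)).
  by move=> n x /step_small[]; rewrite /= addrC addKr.
have [|f1 hf1] := @geometric_pointwise_limit (fun n => jd1 (G n)).
  by move=> n x /step_small[]; rewrite /= [X in X - _]addrC addrK.
have [|f2 hf2] := @geometric_pointwise_limit (fun n => jd2 (G n)).
  by move=> n x /step_small[]; rewrite /= [X in X - _]addrC addrK.
pose F := Jet f f1 f2; exists F.
  move=> r; pose m := (Num.truncn r).+1.
  have rm : r <= m%:R by rewrite ltW // truncnS_gt.
  have [M tM] := eG m m%:R; exists (M + 2).
  apply: taylorWr rm _.
  (* the sum of the bounds on all the corrections from the n-th one on *)
  pose t n : R := 2 * 2^-1 ^+ n.
  have t0 n : 0 <= t n by rewrite mulr_ge0 // exprn_ge0 // invr_ge0.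
  have tG k : taylor m%:R (M + (t m - t (m + k)%N)) (G (m + k)%N).
    elim: k => [|k IHk]; first by rewrite addn0 subrr addr0.
    rewrite addnS /=.
    have -> : t (m + k).+1 = t (m + k)%N - 2^-1 ^+ (m + k).
      by rewrite /t exprS; lra.
    rewrite (_ : M + _ = M + (t m - t (m + k)%N) + 2^-1 ^+ (m + k));
      last by ring.
    apply: taylorD => //; have [_ h _ _] := hstep ((m + k)%N, G (m + k)%N).
    by apply: taylorWr h; rewrite ler_nat leq_addr.
  have tm : t m <= 2.
    by rewrite /t ler_piMr // exprn_ile1 // ?invr_ge0 // invf_le1 // ler1n.
  apply: taylor_closed => e e0.
  have [k hk] := @half_exp_small R 4 e (ler0n _ _) e0.
  exists (G (m + k)%N).
    by apply: taylorW (tG k); have := t0 (m + k)%N; lra.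
  have hmk : 4 * 2^-1 ^+ (m + k) <= e.
    apply: le_trans hk; rewrite ler_wpM2l //.
    by rewrite ler_wiXn2l ?leq_addl // ?invr_ge0 // invf_le1 // ler1n.
  move=> x mx; split; apply: le_trans hmk.
  - exact: hf (leq_addr _ _) mx.
  - exact: hf1 (leq_addr _ _) mx.
  - exact: hf2 (leq_addr _ _) mx.
move=> p Ep; apply/eqP; rewrite -subr_eq0 -modulus_eq0 eq_le modulus_ge0 andbT.
apply/ler_addgt0Pr => e e0; rewrite add0r.
pose m := (Num.truncn (sup_modulus p)).+1.
have mp : sup_modulus p < m%:R by exact: truncnS_gt.
have [k hk] := @half_exp_small R 4 e (ler0n _ _) e0.
have pA : p \in A (m + k)%N.
  apply/inA; split=> //; apply: lt_le_trans mp _; rewrite -natrM ler_nat.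
  by apply: leq_trans (leq_addr k m) _; exact: leq_pmull.
have /(_ m (m + k)%N p (leq_addr _ _)) := hf.
rewrite GA // => h; rewrite modulusBC; apply: le_trans (h _) _.
  exact/polydiscE.
apply: le_trans hk; rewrite ler_wpM2l //.
by rewrite ler_wiXn2l ?leq_addl // ?invr_ge0 // invf_le1 // ler1n.
Qed.

End EntireInterpolation.

(** * Shears of 2 x 2 matrices *)

Lemma det_mx22 (K : comNzRingType) (A : 'M[K]_2) :
  \det A = A 0 0 * A 1 1 - A 0 1 * A 1 0.
Proof.
rewrite (expand_det_row _ 0) !big_ord_recl big_ord0 addr0 /cofactor !det_mx11.
rewrite !mxE /= expr0 expr1 mul1r mulN1r mulrN.
by congr (A _ _ * A _ _ - A _ _ * A _ _); apply/val_inj.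
Qed.

Lemma ord2P (i : 'I_2) : i = 0 \/ i = 1.
Proof. by case: i => -[|[|//]] ?; [left|right]; apply/val_inj. Qed.

Section Shears.
Context {K : numFieldType}.
Implicit Types (A X : 'M[K]_2) (g : K * K -> K).

Lemma ler_mx_norm_entry m n (A : 'M[K]_(m, n)) i j : `|A i j| <= `|A|.
Proof.
have -> : `|A i j| = (`|A (i,j).1 (i,j).2|%:nng)%:num by [].
by rewrite [leRHS]mx_normE num_le; exact: le_bigmax.
Qed.

(** The two entries are those on which the multiplier of a shear depends; [a] and
    [b] are then the partial derivatives, and a quadratic remainder is negligible
    to first order. *)
Lemma differentiable_quadratic m n (f : 'M[K]_(m, n) -> K) (a b M : K)
    i1 j1 i2 j2 (A : 'M[K]_(m, n)) : 0 <= M ->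
  (\forall X \near A, `|f X - f A
      - (a * (X i1 j1 - A i1 j1) + b * (X i2 j2 - A i2 j2))|
    <= M * `|X - A| ^+ 2) ->
  differentiable f A.
Proof.
move=> M0 fM; pose df (X : 'M[K]_(m, n)) : K := a * X i1 j1 + b * X i2 j2.
have df_lin : linear df.
  by move=> c X Y; rewrite /df !mxE /GRing.scale /=; ring.
pose dfM := GRing.isLinear.Build _ _ _ _ _ df_lin.
pose dfL : {linear 'M[K]_(m, n) -> K} := HB.pack df dfM.
have dfc : continuous dfL.
  move=> X; have c0 (c : K) i j :
      {for X, continuous (fun Y : 'M[K]_(m, n) => c * Y i j)}.
    by apply: continuousM; [exact: cst_continuous|exact: coord_continuous].
  exact: (continuousD (c0 a i1 j1) (c0 b i2 j2)).
have small e : 0 < e ->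
    \forall y \near (0 : 'M[K]_(m, n)), `|f (y + A) - (f A + df y)| <= e * `|y|.
  move=> e0; have M1 : 0 < M + 1 by rewrite ltr_wpDl.
  have fM0 : \forall y \near (0 : 'M[K]_(m, n)),
      `|f (y + A) - f A - df y| <= M * `|y| ^+ 2.
    move: fM; rewrite (near_shift 0 A) subr0; apply: filterS => y /=.
    by rewrite addrK !mxE !addrK.
  have d0 : 0 < e / (M + 1) by rewrite divr_gt0.
  have near0 := @nbhs0_lt K 'M[K]_(m, n) _ d0.
  near=> y.
  have /ltW yM : `|y| < e / (M + 1).
    by near: y.
  have yfM : `|f (y + A) - f A - df y| <= M * `|y| ^+ 2 by near: y.
  rewrite opprD addrA; apply: le_trans yfM _.
  rewrite expr2 mulrA ler_wpM2r //.
  apply: le_trans (_ : (M + 1) * `|y| <= _).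
    by rewrite ler_wpM2r // lerDl.
  by rewrite mulrC -ler_pdivlMr.
have dfE : 'd f A = dfL :> ('M[K]_(m, n) -> K).
  by apply: diff_unique dfc _; apply/eqaddoP => e /small.
by apply/diff_locallyP; rewrite dfE; split=> //; apply/eqaddoP => e /small.
Unshelve. all: by end_near. Qed.

(** Column [j] is kept and [g] is evaluated on it, so the multiplier can be
    recovered from the image: this is why shears are invertible. *)
Definition shear (j : 'I_2) g A : 'M[K]_2 :=
  \matrix_(i, k) (A i k + (k != j)%:R * g (A 0 j, A 1 j) * A i j).

Lemma shear_fixed j g A i : shear j g A i j = A i j.
Proof. by rewrite mxE eqxx !mul0r addr0. Qed.

Lemma shear_moved j k g A i : k != j ->
  shear j g A i k = A i k + g (A 0 j, A 1 j) * A i j.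
Proof. by move=> kj; rewrite mxE kj mul1r. Qed.

Lemma det_shear j g A : \det (shear j g A) = \det A.
Proof.
rewrite !det_mx22 !mxE.
have [->|->] := ord2P j.
  by rewrite /=; ring.
by rewrite /=; ring.
Qed.

Lemma shearK j g A : shear j (fun p => - g p) (shear j g A) = A.
Proof.
apply/matrixP => i k; rewrite mxE !shear_fixed mxE; ring.
Qed.

Lemma differentiable_shear j g A :
  differentiable (fun X : 'M[K]_2 => g (X 0 j, X 1 j)) A ->
  differentiable (shear j g) A.
Proof.
move=> dg.
have -> : shear j g = \sum_(i < 2) \sum_(k < 2) (fun X : 'M[K]_2 =>
    (X i k + (k != j)%:R * g (X 0 j, X 1 j) * X i j) *: delta_mx i k).
  apply/funext => X; rewrite [LHS]matrix_sum_delta !fct_sumE.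
  apply: eq_bigr => i _.
  by rewrite fct_sumE; apply: eq_bigr => k _; rewrite mxE.
apply: differentiable_sum => i; apply: differentiable_sum => k.
apply: differentiableZl.
apply: (@differentiableD K 'M[K]_2 K (fun X => X i k)).
  exact: differentiable_coord.
apply: (@differentiableM K 'M[K]_2 (fun X => (k != j)%:R * g (X 0 j, X 1 j))).
  exact: (@differentiableM K 'M[K]_2 (fun X => (k != j)%:R)).
exact: differentiable_coord.
Qed.

End Shears.

(** * Automorphisms of SL_2(C) and bounded sets *)

Section EntireShears.
Context {R : realType}.
Local Notation C := R[i].
Local Notation M2 := 'M[C]_2.
(* topological and normed structures on matrices are inferred from this form *)
Local Notation Cf := (R[i] : numFieldType).
Implicit Types (A X : M2) (J : @jet R).

Lemma differentiable_jet J (j : 'I_2) A : entire J ->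
  differentiable (fun X : 'M[Cf]_2 => J (X 0 j, X 1 j) : Cf) (A : 'M[Cf]_2).
Proof.
move=> eJ; pose p X : C * C := (X 0 j, X 1 j).
pose r := sup_modulus (p A) + 1; have [M [M0 tM]] := eJ r.
have rA : polydisc r (p A) by apply/polydiscE; rewrite ltrDl.
have e0 : (0 : C) <= (4 * M)%:C%C by rewrite ler0c mulr_ge0.
apply: (@differentiable_quadratic C 2 2 (fun X => J (p X)) (jd1 J (p A))
  (jd2 J (p A)) _ 0 j 1 j A e0).
have near1 : \forall X \near (A : 'M[Cf]_2), `|X - (A : 'M[Cf]_2)| < 1.
  have := @nbhs0_lt Cf 'M[Cf]_2 _ (@ltr01 Cf).
  by rewrite (near_shift (A : 'M[Cf]_2) 0) sub0r; apply: filterS.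
apply: filterS near1 => X XA.
have hd i : modulus (X i j - A i j) < 1 /\
    (modulus (X i j - A i j))%:C%C <= `|X - A|.
  have := ler_mx_norm_entry (X - A) i j; rewrite !mxE modulusE => h.
  by split=> //; have := le_lt_trans h XA; rewrite -[1]/(1%:C)%C ltcR.
have rX : polydisc r (p X).
  have near_entry i : modulus (X i j) < modulus (A i j) + 1.
    rewrite -[X i j](subrK (A i j)) addrC.
    by apply: le_lt_trans (ler_modulusD _ _) _; rewrite ltrD2l; case: (hd i).
  split; apply: lt_le_trans (near_entry _) _;
    by rewrite lerD2r le_max lexx ?orbT.
have [_ _ _ _ hT] := tM _ _ rA rX.
rewrite modulusE; apply: le_trans (_ : (M * dist1 (p A) (p X) ^+ 2)%:C%C <= _).
  by rewrite lecR.
rewrite [in leLHS]rmorphM rmorphXn /= [(4 * M)%:C%C]rmorphM /= mulrAC [leRHS]mulrC.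
rewrite ler_wpM2l ?ler0c //.
have -> : (4%:C)%C = 2 ^+ 2 :> C by rewrite -natrX rmorph_nat.
rewrite -exprMn lerXn2r ?nnegrE ?ler0c ?dist1_ge0 ?mulr_ge0 //.
have [[_ h0] [_ h1]] := (hd 0, hd 1).
by rewrite mulr_natl mulr2n /dist1 rmorphD lerD.
Qed.

Definition jopp J := jmul (jcst (-1)) J.

Lemma entire_opp J : entire J -> entire (jopp J).
Proof. by move=> eJ; apply: entireM => //; exact: entire_cst. Qed.

Lemma joppE J : jval (jopp J) = fun p => - J p.
Proof. by apply/funext => p /=; rewrite mulN1r. Qed.

Lemma joppK J : (fun p => - jopp J p) = J :> (_ -> _).
Proof. by apply/funext => p; rewrite joppE opprK. Qed.

Lemma automorphism_shears j1 j2 J1 J2 : entire J1 -> entire J2 ->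
  automorphism (SL2 C) (shear j2 J2 \o shear j1 J1).
Proof.
move=> e1 e2; exists (shear j1 (jopp J1) \o shear j2 (jopp J2)).
have d j J (A : 'M[Cf]_2) : entire J ->
    differentiable (shear j J : 'M[Cf]_2 -> 'M[Cf]_2) A.
  by move=> eJ; apply: (@differentiable_shear Cf); exact: differentiable_jet.
have hol ja jb Ja Jb : entire Ja -> entire Jb ->
    holomorphic_on (SL2 C) (shear jb Jb \o shear ja Ja).
  move=> ea eb A _; exists setT, (shear jb Jb \o shear ja Ja); split=> //.
    exact: openT.
  by move=> X _; apply: (@differentiable_comp Cf); exact: d.
have sK j J (X : M2) : shear j (jopp J) (shear j J X) = X.
  by rewrite joppE shearK.
have sV j J (X : M2) : shear j J (shear j (jopp J) X) = X.
  by rewrite -{1}(joppK J) shearK.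
split.
- move=> A A1; split; first by rewrite /SL2 /mkset /comp !det_shear.
  by rewrite /comp !sK.
- move=> A A1; split; first by rewrite /SL2 /mkset /comp !det_shear.
  by rewrite /comp !sV.
- exact: hol.
- by apply: hol; exact: entire_opp.
Qed.

Lemma compact_bounded_entries (K : set 'M[Cf]_2) : compact K ->
  exists B : R, forall X, K X -> forall i j, modulus (X i j) <= B.
Proof.
rewrite compact_cover => /(_ nat setT (fun n => ball (0 : 'M[Cf]_2) n%:R)).
move=> [n _||D _ KD]; first exact: ball_open.
  move=> X _; have Xr : `|X| \is Num.real by exact: normr_real.
  exists (Num.truncn (complex.Re `|X|)).+1 => //=.
  rewrite mx_norm_ball /ball_ /= sub0r normrN -(RRe_real Xr).
  by rewrite -(rmorph_nat (real_complex R)) ltcR truncnS_gt.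
exists (\max_(n <- finmap.enum_fset D) n)%:R => X /KD[n /= nD].
rewrite mx_norm_ball /ball_ /= sub0r normrN => Xn i j.
apply: (@le_trans _ _ n%:R); last first.
  by rewrite ler_nat; apply: leq_bigmax_seq.
rewrite -(@lecR R) -modulusE rmorph_nat; apply: (le_trans _ (ltW Xn)).
exact: ler_mx_norm_entry.
Qed.

End EntireShears.

(** * Matrices over a subring whose nonzero elements have modulus at least 1 *)

Section SeparatedRing.
Context {R : realType} (O : set R[i]).
Local Notation C := R[i].
Local Notation M2 := 'M[C]_2.
Implicit Types (A : M2) (r : R).

Hypothesis OB : forall x y, O x -> O y -> O (x - y).
Hypothesis OM : forall x y, O x -> O y -> O (x * y).
Hypothesis O_sep : forall x, O x -> x != 0 -> 1 <= modulus x.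

Definition SL2_over : set M2 := [set A | SL2 C A /\ forall i j, O (A i j)].

Lemma separated_eq x y : O x -> O y -> modulus (x - y) < 1 -> x = y.
Proof.
move=> Ox Oy xy; apply/eqP; rewrite -subr_eq0; apply: contraTT xy => xy.
by rewrite -leNgt; apply: O_sep => //; exact: OB.
Qed.

(** Two elements of the same square of side 1/2 are at distance less than 1, so
    they are equal; a bounded set meets finitely many squares. *)
Lemma finite_bounded_separated r : finite_set [set x | O x /\ modulus x < r].
Proof.
set S := [set _ | _].
pose f (x : C) := (Num.truncn (2 * (complex.Re x + r)),
                   Num.truncn (2 * (complex.Im x + r))).
have fbound (a : R) : `|a| < r -> 0 <= 2 * (a + r) < 4 * r.
  by rewrite ltr_norml => /andP[a1 a2]; apply/andP; split; lra.
have Sbound x : S x -> (0 <= 2 * (complex.Re x + r) < 4 * r) /\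
    (0 <= 2 * (complex.Im x + r) < 4 * r).
  move=> [_ xr]; split; apply: fbound; apply: le_lt_trans xr.
    exact: ler_modulus_Re.
  exact: ler_modulus_Im.
have finj : {in S &, injective f}.
  move=> x y; rewrite !inE => Sx Sy [].
  have [/andP[x1 _] /andP[x2 _]] := Sbound x Sx.
  have [/andP[y1 _] /andP[y2 _]] := Sbound y Sy.
  have /andP[a1 a2] := truncn_itv x1; have /andP[a3 a4] := truncn_itv x2.
  have /andP[b1 b2] := truncn_itv y1; have /andP[b3 b4] := truncn_itv y2.
  move=> e1 e2; rewrite e1 in a1 a2; rewrite e2 in a3 a4.
  rewrite -natr1 in a2; rewrite -natr1 in a4.
  rewrite -natr1 in b2; rewrite -natr1 in b4.
  apply: separated_eq; [by case: Sx|by case: Sy|].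
  apply: le_lt_trans (ler_modulus_ReIm _) _; rewrite !raddfB /=.
  have h1 : `|complex.Re x - complex.Re y| < 2^-1.
    by rewrite ltr_norml; apply/andP; split; lra.
  have h2 : `|complex.Im x - complex.Im y| < 2^-1.
    by rewrite ltr_norml; apply/andP; split; lra.
  lra.
rewrite -(eq_finite_set (inj_card_eq finj)).
pose N := (Num.truncn (4 * r)).+1.
apply: sub_finite_set (finite_setX (finite_II N) (finite_II N)).
have truncN (a : R) : 0 <= a < 4 * r -> (Num.truncn a < N)%N.
  move=> /andP[a0 ar]; rewrite truncn_lt_nat //.
  exact: lt_trans ar (truncnS_gt _).
by move=> _ [x /Sbound[h1 h2] <-]; split=> /=; exact: truncN.
Qed.

Lemma column_neq0 A (j : 'I_2) : SL2 C A -> (A 0 j, A 1 j) <> 0.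
Proof.
rewrite /SL2 /= det_mx22 => A1 [a0 a1]; move: A1.
by have [j0|j0] := ord2P j; rewrite j0 in a0 a1;
  rewrite a0 a1 mul0r mulr0 subr0 => /esym/eqP; rewrite oner_eq0.
Qed.

Lemma sup_modulus_gt0 (p : C * C) : (0 < sup_modulus p) <-> (p <> 0).
Proof.
rewrite lt_max !modulus_gt0; case: p => a b /=; split.
  by move=> h [a0 b0]; move: h; rewrite a0 b0 eqxx.
move=> h; rewrite -negb_and; apply/negP => /andP[/eqP a0 /eqP b0].
by apply: h; rewrite a0 b0.
Qed.

Lemma separated_column_ge1 A j : SL2_over A -> 1 <= sup_modulus (A 0 j, A 1 j).
Proof.
move=> [A1 OA]; have /sup_modulus_gt0 := @column_neq0 A j A1.
rewrite lt_max !modulus_gt0 le_max => /orP[] h; apply/orP; [left|right];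
  exact: (O_sep (OA _ _) h).
Qed.

Definition second_col A : C * C := (A 0 1, A 1 1).
Definition first_col A : C * C := (A 0 0, A 1 0).

Lemma finite_bounded_second_col r :
  finite_set [set p | (second_col @` SL2_over) p /\ sup_modulus p < r].
Proof.
have fin := finite_bounded_separated r.
apply: sub_finite_set (finite_setX fin fin).
move=> _ [[A [_ OA] <-]]; rewrite gt_max => /andP[h1 h2].
by split; split=> //=; exact: OA.
Qed.

Definition sqnorm (p : C * C) : R := modulus p.1 ^+ 2 + modulus p.2 ^+ 2.

Lemma sqnormE p : (sqnorm p)%:C%C = p.1 * (p.1^*)%C + p.2 * (p.2^*)%C.
Proof. by rewrite rmorphD !rmorphXn /= -!modulusE !sqr_normc. Qed.

Lemma sqnorm_ge p : sup_modulus p ^+ 2 <= sqnorm p.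
Proof.
rewrite /sup_modulus /sqnorm maxEle; case: ifP => _;
  by rewrite ?lerDl ?lerDr exprn_ge0 ?modulus_ge0.
Qed.

(** The difference of the first columns is orthogonal to the second column for
    the determinant pairing, hence proportional to it; the coefficient is itself
    a 2 x 2 determinant with entries in the ring. *)
Lemma column_shift A A0 : SL2_over A -> SL2_over A0 ->
    second_col A0 = second_col A ->
  exists2 n, O n & forall i, A i 0 = A0 i 0 + n * A i 1.
Proof.
move=> [A1 OA] [A01 OA0] [e0 e1].
exists (A0 0 0 * A 1 0 - A0 1 0 * A 0 0); first by apply: OB; apply: OM.
move: A1 A01; rewrite /SL2 /= !det_mx22 e0 e1 => A1 A01 i.
have [->|->] := ord2P i.
- apply/eqP; rewrite -subr_eq0; apply/eqP.
  transitivity (A 0 0 * (1 - (A0 0 0 * A 1 1 - A 0 1 * A0 1 0))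
                - A0 0 0 * (1 - (A 0 0 * A 1 1 - A 0 1 * A 1 0))).
    by ring.
  by rewrite A1 A01 subrr !mulr0 subrr.
- apply/eqP; rewrite -subr_eq0; apply/eqP.
  transitivity (A 1 0 * (1 - (A0 0 0 * A 1 1 - A 0 1 * A0 1 0))
                - A0 1 0 * (1 - (A 0 0 * A 1 1 - A 0 1 * A 1 0))).
    by ring.
  by rewrite A1 A01 subrr !mulr0 subrr.
Qed.

(** The point -1/2 stays away from the ring: 0 is at distance 1/2, and the other
    elements are at distance at least 1 - 1/2. *)
Lemma half_separated n : O n -> 2^-1 <= modulus (n + 2^-1).
Proof.
move=> On; have [->|n0] := eqVneq n 0; first by rewrite add0r modulus_half.
have := O_sep On n0; have := ler_modulusB n (- 2^-1).
by rewrite modulusN opprK modulus_half; lra.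
Qed.

(** With this multiplier the hermitian product of the first column of [A0],
    moved by the shear, with its second column [p] is half of |p|^2. *)
Definition tilt A0 (p : C * C) : C :=
  2^-1 - (A0 0 0 * (p.1^*)%C + A0 1 0 * (p.2^*)%C) / (sqnorm p)%:C%C.

(** By the choice of [tilt] the hermitian product of the new first column with
    the second column is (n + 1/2) |p|^2; comparing with the Cauchy-Schwarz bound
    (here for the sup norm, hence the factor 2) gives the estimate. *)
Lemma tilted_column_ge A A0 n g : SL2_over A ->
    (forall i, A i 0 = A0 i 0 + n * A i 1) ->
    g (second_col A) = tilt A0 (second_col A) ->
  modulus (n + 2^-1) * sup_modulus (second_col A)
    <= 2 * sup_modulus (first_col (shear 1 g A)).
Proof.
move=> GA On_shift gA; set p := second_col A; set m := sup_modulus p.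
have m1 : 1 <= m by exact: separated_column_ge1.
have m0 : 0 < m by exact: lt_le_trans m1.
have sm : m ^+ 2 <= sqnorm p := sqnorm_ge p.
have s0 : 0 < sqnorm p by apply: lt_le_trans sm; rewrite exprn_gt0.
pose u i := A i 0 + g p * A i 1.
have -> : first_col (shear 1 g A) = (u 0, u 1).
  by rewrite /first_col !shear_moved.
have pairing : u 0 * (p.1^*)%C + u 1 * (p.2^*)%C =
    (n + 2^-1) * (sqnorm p)%:C%C.
  have sC : (sqnorm p)%:C%C != 0 :> C.
    by rewrite (inj_eq (@complexI R) _ 0) gt_eqF.
  set X := A0 0 0 * (p.1^*)%C + A0 1 0 * (p.2^*)%C.
  have tS : tilt A0 p * (sqnorm p)%:C%C = 2^-1 * (sqnorm p)%:C%C - X.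
    by rewrite mulrBl divfK.
  rewrite /u !On_shift gA -/p.
  rewrite (_ : _ + _ = X + (n + tilt A0 p) *
    (p.1 * (p.1^*)%C + p.2 * (p.2^*)%C)); last by rewrite /X /=; ring.
  by rewrite -sqnormE [(n + tilt _ _) * _]mulrDl tS; ring.
have := congr1 (@modulus R) pairing; rewrite [in RHS]modulusM modulus_real.
rewrite ger0_norm ?(ltW s0) // => pairing_modulus.
set U := sup_modulus _.
have bnd (i : 'I_2) (z : C) : modulus z <= m -> modulus (u i) <= U ->
    modulus (u i * (z^*)%C) <= U * m.
  by move=> h1 h2; rewrite modulusM modulus_conj ler_pM ?modulus_ge0.
have b0 : modulus (u 0 * (p.1^*)%C) <= U * m.
  by apply: bnd; rewrite le_max lexx ?orbT.
have b1 : modulus (u 1 * (p.2^*)%C) <= U * m.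
  by apply: bnd; rewrite le_max lexx ?orbT.
have := ler_modulusD (u 0 * (p.1^*)%C) (u 1 * (p.2^*)%C).
rewrite pairing_modulus => h.
rewrite -(ler_pM2r m0) -mulrA -expr2.
apply: le_trans (_ : modulus (n + 2^-1) * sqnorm p <= _).
  by rewrite ler_wpM2l ?modulus_ge0.
lra.
Qed.

End SeparatedRing.

(** * Tameness of SL_2 over such a subring *)

Section TameSeparatedRing.
Context {R : realType} (O : set R[i]).
Local Notation C := R[i].
Local Notation Cf := (R[i] : numFieldType).
Local Notation M2 := 'M[C]_2.
Implicit Types (A : M2) (r : R).

Hypothesis O1 : O 1.
Hypothesis OB : forall x y, O x -> O y -> O (x - y).
Hypothesis OM : forall x y, O x -> O y -> O (x * y).
Hypothesis O_sep : forall x, O x -> x != 0 -> 1 <= modulus x.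

Local Notation Gamma := (SL2_over O).

(** A matrix is determined by its second column p and by the element n
    of [column_shift].  When the sheared first column is bounded, so is p because
    |n + 1/2| >= 1/2, and so is n because |p| >= 1. *)
Lemma separating_shear : exists2 J : @jet R, entire J &
  forall r, finite_set
    [set A | Gamma A /\ sup_modulus (first_col (shear 1 J A)) < r].
Proof.
have [base hbase] : exists base : C * C -> M2,
    forall A, Gamma A -> Gamma (base (second_col A)) /\
      second_col (base (second_col A)) = second_col A.
  have /choice[base hbase] : forall p : C * C, exists A0 : M2,
      (second_col @` Gamma) p -> Gamma A0 /\ second_col A0 = p.
    move=> p; have [[A0 GA0 <-]|np] := pselect ((second_col @` Gamma) p).
      by exists A0.
    by exists 0 => /np.
  by exists base => A GA; apply: hbase; exists A.
have [J eJ hJ] := entire_interpolation (fun p => tilt (base p) p)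
  (finite_bounded_second_col OB O_sep).
exists J => // r.
have fin1 := finite_bounded_second_col OB O_sep (4 * r + 1).
have fin2 := finite_bounded_separated OB O_sep (2 * r + 1).
(* second column p, and as first column that of base p plus n p *)
pose rebuild (pn : (C * C) * C) : M2 := \matrix_(i, k)
  (let p := if i == 0 then pn.1.1 else pn.1.2 in
   if k == 0 then base pn.1 i 0 + pn.2 * p else p).
apply: sub_finite_set (finite_image rebuild (finite_setX fin1 fin2)).
move=> A [GA Ar]; have [GA0 eA0] := hbase A GA.
have [n On hn] := column_shift OB OM GA GA0 eA0.
have J1 : J (second_col A) = tilt (base (second_col A)) (second_col A).
  by apply: hJ; exists A.
have := tilted_column_ge O_sep GA hn J1.
have nhalf := half_separated O_sep On.
have p1 : 1 <= sup_modulus (second_col A) := separated_column_ge1 O_sep 1 GA.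
set m := sup_modulus (second_col A) in p1 *.
set U := sup_modulus (first_col _) in Ar *.
set h := modulus (n + 2^-1) in nhalf * => hmU.
exists (second_col A, n); last first.
  apply/matrixP => i k; rewrite mxE /=.
  by have [->|->] := ord2P i; have [->|->] := ord2P k; rewrite /= ?hn.
split=> /=; split=> //.
- by exists A.
- have : 2^-1 * m <= h * m by rewrite ler_wpM2r // (le_trans ler01).
  by rewrite -/m; lra.
- have hm : h * 1 <= h * m by rewrite ler_wpM2l // modulus_ge0.
  have := ler_modulusB n (- 2^-1).
  by rewrite modulusN modulus_half opprK -/h; lra.
Qed.

Lemma uniform_threshold (T : eqType) (F : set T) (P : T -> R -> Prop) :
  finite_set F -> (forall x, F x -> exists t0, forall t, t0 <= t -> P x t) ->
  exists t0, forall x, F x -> forall t, t0 <= t -> P x t.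
Proof.
move=> /finite_seqP[s ->]; elim: s => [|a s IHs] h; first by exists 0.
have [t1 ht1] : exists t1, forall t, t1 <= t -> P a t.
  by apply: h => /=; exact: mem_head.
have [|t2 ht2] := IHs.
  by move=> x xs; apply: h; rewrite /= in_cons xs orbT.
exists (Num.max t1 t2) => x /=; rewrite in_cons => /orP[/eqP ->|xs] t.
  by rewrite ge_max => /andP[/ht1].
by rewrite ge_max => /andP[_]; exact: ht2.
Qed.

(** A determinant 1 matrix has a nonzero first column, so a large multiple of it
    dominates the second column. *)
Lemma shear_escapes (rho : M2 -> R) (c : R) A :
  exhaustion (SL2 C : set 'M[Cf]_2) rho -> SL2 C A ->
  exists t0, forall t : R, t0 <= t -> c <= rho (shear 0 (fun=> t%:C%C) A).
Proof.
move=> [_ _ cpt] A1; have [B hB] := compact_bounded_entries (cpt c).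
have p0 : 0 < sup_modulus (first_col A).
  by apply/sup_modulus_gt0; exact: (@column_neq0 _ _ 0 A1).
pose D := Num.max 0 B + modulus (A 0 1) + modulus (A 1 1) + 1.
have D0 : 0 < D.
  by rewrite ltr_wpDl // !addr_ge0 ?modulus_ge0 // le_max lexx.
exists (D / sup_modulus (first_col A)) => t Dt.
rewrite leNgt; apply/negP => rho_lt.
have t0 : 0 <= t by apply: le_trans Dt; rewrite divr_ge0 // ltW.
have sX : SL2 C (shear 0 (fun=> t%:C%C) A) by rewrite /SL2 /mkset det_shear.
have := hB _ (conj sX (ltW rho_lt)).
have entry (i : 'I_2) : D <= t * modulus (A i 0) ->
    B < modulus (shear 0 (fun=> t%:C%C) A i 1).
  rewrite shear_moved // [A i 1 + _]addrC => Dti.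
  have := ler_modulusB (t%:C%C * A i 0) (- A i 1).
  rewrite opprK modulusN modulusM modulus_real ger0_norm //.
  have : modulus (A i 1) <= modulus (A 0 1) + modulus (A 1 1).
    have [->|->] := ord2P i.
      by rewrite lerDl modulus_ge0.
    by rewrite lerDr modulus_ge0.
  have : B <= Num.max 0 B by rewrite le_max lexx orbT.
  by rewrite /D in Dti; lra.
move: Dt; rewrite ler_pdivrMr // {1}/sup_modulus maxEle /=.
case: ifP => _ /entry h hle; [have := hle 1 1|have := hle 0 1]; rewrite leNgt h.
by [].
by [].
Qed.

Lemma infinite_SL2_over : infinite_set Gamma.
Proof.
have O0 : O 0 by rewrite -(subrr 1); exact: OB.
have On (n : nat) : O n%:R.
  elim: n => [//|n IHn]; rewrite -natr1 -[X in _ + X]opprK.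
  by apply: OB => //; rewrite -sub0r; exact: OB.
move=> /(finite_image (fun A => A 0 1)) fin.
have natr_inj : {in [set: nat] &, injective (fun n => n%:R : C)}.
  by move=> m n _ _ /eqP; rewrite eqr_nat => /eqP.
apply: infinite_nat; rewrite -(eq_finite_set (inj_card_eq natr_inj)).
apply: sub_finite_set fin => _ [n _ <-].
exists (shear 0 (fun=> n%:R) 1%:M); last first.
  by rewrite shear_moved // !mxE /= mulr1 add0r.
split; first by rewrite /SL2 /mkset det_shear det1.
move=> i j; rewrite !mxE.
have O01 (b : bool) : O b%:R by case: b.
rewrite -[X in _ + X]opprK; apply: OB => //; rewrite -sub0r; apply: OB => //.
by do 2![apply: OM => //].
Qed.

(** Entries of distinct matrices of the group differ by at least 1 somewhere,
    whereas near a limit point there would be two distinct ones at distance less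
    than 1. *)
Lemma discrete_SL2_over :
  discrete_subset (SL2 C : set 'M[Cf]_2) (Gamma : set 'M[Cf]_2).
Proof.
split=> [A []//|X _ limX].
have nbhs_ball (e : Cf) : 0 < e -> nbhs (X : 'M[Cf]_2) (ball (X : 'M[Cf]_2) e).
  by move=> e0; exact: nbhsx_ballx.
have half0 : 0 < 2^-1 :> Cf by rewrite invr_gt0.
have [Y [YX [_ OY]]] := limX _ (nbhs_ball _ half0).
rewrite mx_norm_ball /ball_ /= => XY.
have XY0 : 0 < `|(X : 'M[Cf]_2) - Y| by rewrite normr_gt0 subr_eq0 eq_sym.
have [Z [ZX [_ OZ]]] := limX _ (nbhs_ball _ XY0).
rewrite mx_norm_ball /ball_ /= => XZ.
suff YZ : Y = Z by rewrite YZ ltxx in XZ.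
apply/matrixP => i j; apply: (separated_eq OB O_sep); [exact: OY|exact: OZ|].
rewrite -(@ltcR R) -modulusE.
have -> : Y i j - Z i j = (X i j - Z i j) - (X i j - Y i j) by ring.
apply: le_lt_trans (ler_normB _ _) _.
rewrite [ltRHS](_ : _ = 2^-1 + 2^-1 :> Cf); last by rewrite -[2^-1]div1r -splitr.
have entry (W : 'M[Cf]_2) : `|X i j - W i j| <= `|(X : 'M[Cf]_2) - W|.
  by have := ler_mx_norm_entry ((X : 'M[Cf]_2) - W) i j; rewrite !mxE.
apply: ltrD; first exact: le_lt_trans (entry Z) (lt_trans XZ XY).
exact: le_lt_trans (entry Y) XY.
Qed.

(** The multiplier of the second shear only has to beat finitely many thresholds
    at each sheared first column. *)
Theorem tame_SL2_over : tame (SL2 C : set 'M[Cf]_2) (Gamma : set 'M[Cf]_2).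
Proof.
split; [exact: infinite_SL2_over|exact: discrete_SL2_over|].
move=> rho hrho zeta _.
have [J1 eJ1 fin1] := separating_shear.
pose A' A := shear 1 J1 A.
have detA' A : Gamma A -> SL2 C (A' A).
  by case=> A1 _; rewrite /SL2 /mkset det_shear.
pose fiber (p : C * C) : set M2 := [set A | Gamma A /\ first_col (A' A) = p].
have /choice[T hT] : forall p, exists t : R, forall A, fiber p A ->
    zeta A <= rho (shear 0 (fun=> t%:C%C) (A' A)).
  move=> p; have [||t0 ht0] := @uniform_threshold _ (fiber p)
    (fun A t => zeta A <= rho (shear 0 (fun=> t%:C%C) (A' A))); last first.
  - by exists t0 => A pA; exact: ht0.
  - by move=> A [GA _]; apply: shear_escapes => //; exact: detA'.
  - apply: sub_finite_set (fin1 (sup_modulus p + 1)) => A [GA <-].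
    by split=> //; rewrite ltrDl.
have [|J2 eJ2 hJ2] := @entire_interpolation R ((first_col \o A') @` Gamma)
  (fun p => (T p)%:C%C).
  move=> r; apply: sub_finite_set (finite_image (first_col \o A') (fin1 r)).
  by move=> _ [[A GA <-] Ar]; exists A.
exists (shear 0 J2 \o shear 1 J1); split; first exact: automorphism_shears.
move=> A GA; have := hT (first_col (A' A)) A (conj GA erefl).
congr (_ <= rho _); apply/matrixP => i k; rewrite [LHS]mxE [RHS]mxE.
by rewrite (hJ2 (first_col (A' A))) //; exists A.
Qed.

End TameSeparatedRing.

(** * Rings of integers of Q and of imaginary quadratic fields *)

Section IntegersOfK.

(** The question is transported to the field of algebraic numbers, where rational
    algebraic integers are known to be integers. *)
Lemma integral_ratr (F : numFieldType) (a : rat) :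
  integralOver (intr : int -> F) (ratr a) -> exists m : int, a = m%:~R.
Proof.
move=> [p p_mon pa].
have map_ratr (L : numFieldType) :
    map_poly intr p = map_poly (ratr : rat -> L) (map_poly intr p).
  by rewrite -map_poly_comp; apply: eq_map_poly => m /=; rewrite ratr_int.
rewrite map_ratr fmorph_root in pa.
have Aa : (ratr a : algC) \in Aint.
  apply: (@root_monic_Aint (map_poly intr p)).
  - by rewrite map_ratr fmorph_root.
  - by rewrite monic_map.
  - by apply/polyOverP => i; rewrite coef_map /= intr_int.
have /intrP[m ma] := Cint_rat_Aint (Crat_rat a) Aa.
exists m; apply: (fmorph_inj (ratr : {rmorphism rat -> algC})).
by rewrite /= ma rmorph_int.
Qed.

Lemma integral_intr_rmorph (B L : nzRingType) (f : {rmorphism B -> L}) (x : B) :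
  integralOver (intr : int -> B) x -> integralOver (intr : int -> L) (f x).
Proof.
move=> /(integral_rmorph f)[p p_mon px]; exists p => //.
by rewrite (eq_map_poly (g := f \o intr)) // => m /=; rewrite rmorph_int.
Qed.

Context {R : realType} (K : fieldExtType rat) (iota : {rmorphism K -> R[i]}).

Lemma modulus_nonzero_integral_ratr (a : rat) :
  integralOver (intr : int -> R[i]) (ratr a) -> a != 0 ->
  1 <= modulus (ratr a : R[i]).
Proof.
move=> /integral_ratr[m ->]; rewrite intr_eq0 ratr_int => m0.
rewrite -(@rmorph_int _ _ (real_complex R)) modulus_real -intr_norm ler1z.
by rewrite -gtz0_ge1 normr_gt0.
Qed.

Lemma iota_alg (a : rat) : iota (a *: 1) = ratr a.
Proof. exact: (fmorph_eq_rat (iota \o in_alg K)). Qed.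

Lemma quadratic_span (x y : K) : \dim {:K} = 2%N -> x \notin 1%VS ->
  exists a b : rat, y = a *: 1 + b *: x.
Proof.
move=> dimK x1.
have sub1 : ((1 : {vspace K}) <= 1 + <[x]>)%VS by exact: addvSl.
have U2 : (\dim {:K} <= \dim (1 + <[x]>)%VS)%N.
  rewrite dimK ltnNge; apply: contra x1 => U1.
  have /eqP -> : (1%VS == (1 + <[x]>)%VS :> {vspace K}).
    by rewrite eqEdim sub1 dimv1.
  exact: (subvP (addvSr _ _)) (memv_line x).
have : y \in (1 + <[x]>)%VS.
  suff /eqP -> : ((1 + <[x]>)%VS == fullv :> {vspace K}) by exact: memvf.
  by rewrite eqEdim subvf.
by case/memv_addP => _ /vlineP[a ->] [_ /vlineP[b ->] ->]; exists a, b.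
Qed.

Lemma ratr_real (a : rat) : (ratr a : R[i]) = ((ratr a : R)%:C)%C.
Proof. by rewrite -(fmorph_rat (real_complex R)). Qed.

Lemma real_image_embeds :
  (forall y, complex.Im (iota y) = 0) -> inhabited {rmorphism K -> R}.
Proof.
move=> im0; pose f y : R := complex.Re (iota y).
have fC y : ((f y)%:C)%C = iota y.
  by rewrite /f; have := im0 y; case: (iota y) => a b /= ->.
have fB : additive f.
  by move=> u v; apply: complexI; rewrite rmorphB /= !fC rmorphB.
have fM : multiplicative f.
  split=> [u v|]; apply: complexI; first by rewrite rmorphM /= !fC rmorphM.
  by rewrite fC !rmorph1.
pose fa := GRing.isAdditive.Build _ _ _ fB.
pose fm := GRing.isMultiplicative.Build _ _ _ fM.
pose F : {rmorphism K -> R} := HB.pack f fa fm.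
by constructor.
Qed.

(** If x is not rational then 1 and x span K, so z = iota x is not real, lest
    iota embed K into the real field.  A relation z^2 = n + s z with n and s
    rational is also satisfied by the conjugate of z; as the two differ, their
    sum is s and their product is -n.  Thus |z|^2 is rational, and it is integral
    as the product of two integral elements. *)
Lemma ring_of_integers_separated (x : K) :
  {:K}%VS = 1%VS \/ imaginary_quadratic R K ->
  ring_of_integers K x -> x != 0 -> 1 <= modulus (iota x).
Proof.
move=> hK Ox x0; have Oz := integral_intr_rmorph iota Ox.
set z := iota x in Oz *.
have z0 : z != 0 by rewrite fmorph_eq0.
have [/vlineP[a xa]|x1] := boolP (x \in (1%VS : {vspace K})).
  have za : z = ratr a by rewrite /z xa iota_alg.
  rewrite za; apply: modulus_nonzero_integral_ratr; first by rewrite -za.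
  by rewrite -(fmorph_eq0 (ratr : {rmorphism rat -> R[i]})) /= -za.
case: hK => [K1|[dimK noR]]; first by rewrite -K1 memvf in x1.
have span y := quadratic_span y dimK x1.
have imz : complex.Im z != 0.
  apply/negP => /eqP imz; apply: noR; apply: real_image_embeds => y.
  have [a [b ->]] := span y.
  rewrite rmorphD /= iota_alg -[b *: x]mulr_algl rmorphM /= iota_alg -/z.
  rewrite !ratr_real; case: (z) imz => u v /= ->.
  by rewrite !mulr0 mul0r !addr0.
have [n [s x2]] := span (x * x).
have z2 : z * z = ratr n + ratr s * z.
  rewrite /z -rmorphM x2 rmorphD /= iota_alg -[s *: x]mulr_algl rmorphM /=.
  by rewrite iota_alg.
have zc2 : (z^*)%C * (z^*)%C = ratr n + ratr s * (z^*)%C.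
  by rewrite -rmorphM z2 rmorphD fmorph_rat [_ (ratr s * z)]rmorphM fmorph_rat.
have zcD : z != (z^*)%C.
  apply: contra imz; case: (z) => u v; rewrite eq_complex /= => /andP[_].
  by rewrite eq_sym -subr_eq0 -opprD oppr_eq0 -mulr2n mulrn_eq0.
have sum_conj : z + (z^*)%C = ratr s.
  apply: (mulfI (_ : z - (z^*)%C != 0)); first by rewrite subr_eq0.
  have -> : (z - (z^*)%C) * (z + (z^*)%C) = z * z - (z^*)%C * (z^*)%C by ring.
  by rewrite z2 zc2; ring.
have norm_rat : z * (z^*)%C = ratr (- n).
  have -> : z * (z^*)%C = z * (z + (z^*)%C) - z * z by ring.
  by rewrite sum_conj z2 rmorphN; ring.
have : 1 <= modulus (z * (z^*)%C).
  have Oc := integral_intr_rmorph (@conjc R) Oz.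
  have := integral_mul Oz Oc; rewrite norm_rat => On.
  apply: modulus_nonzero_integral_ratr => //.
  rewrite -(fmorph_eq0 (ratr : {rmorphism rat -> R[i]})) /= -norm_rat.
  by rewrite mulf_neq0 // conjc_eq0.
rewrite modulusM modulus_conj -expr2 => h.
by rewrite -(@ler_pXn2r _ 2) ?nnegrE ?modulus_ge0 ?expr1n.
Qed.

Lemma map_SL2_integers :
  map_mx iota @` SL2_integers K = SL2_over (iota @` ring_of_integers K).
Proof.
rewrite eqEsubset; split=> [_ [A [A1 OA] <-]|A [A1 OA]].
  split=> [|i j]; first by rewrite /SL2 /mkset det_map_mx A1 rmorph1.
  by rewrite mxE; exists (A i j).
have /choice[f hf] : forall ij : 'I_2 * 'I_2, exists x,
    ring_of_integers K x /\ iota x = A ij.1 ij.2.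
  by move=> [i j]; have [x Ox xA] := OA i j; exists x.
pose B : 'M[K]_2 := \matrix_(i, j) f (i, j).
have BA : map_mx iota B = A.
  by apply/matrixP => i j; rewrite !mxE; case: (hf (i, j)).
exists B => //; split=> [|i j]; last by rewrite mxE; case: (hf (i, j)).
by apply: (fmorph_inj iota); rewrite -det_map_mx BA A1 rmorph1.
Qed.

End IntegersOfK.

Theorem corollary11p3 (R : realType) (K : fieldExtType rat)
    (iota : {rmorphism K -> R[i]})
    (hK : {:K}%VS = 1%VS \/ imaginary_quadratic R K) :
  tame (SL2 R[i]) (map_mx iota @` SL2_integers K).
Proof.
rewrite map_SL2_integers; apply: tame_SL2_over.
- by exists 1; [exact: integral1|rewrite rmorph1].
- move=> _ _ [x Ox <-] [y Oy <-].
  by exists (x - y); [exact: integral_sub|rewrite rmorphB].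
- move=> _ _ [x Ox <-] [y Oy <-].
  by exists (x * y); [exact: integral_mul|rewrite rmorphM].
- move=> _ [x Ox <-]; rewrite fmorph_eq0.
  exact: ring_of_integers_separated.
Qed.
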